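(* The image of every oblique line under $\exp \circ \exp \circ \exp$ is dense in $\mathbb{C}$. In other words, for each $p \in \mathbb{C}$ and every $\alpha \in \mathbb{R} \setminus \{0\}$, $$\overline{\exp \circ \exp \circ \exp (L_\alpha(p))} = \mathbb{C}.$$
   Context: Here $\exp : \mathbb{C} \to \mathbb{C}$, $z \mapsto e^z$, is the complex exponential. For $p \in \mathbb{C}$ and $\alpha \in \mathbb{R}$, $L_\alpha(p) := \{p + t(i+\alpha) : t \in \mathbb{R}\}$. An oblique line is a line in $\mathbb{C}$ that is neither horizontal nor vertical, i.e. a line of the form $L_\alpha(p)$ with $p\in\mathbb{C}$ and $\alpha \neq 0$. The overline denotes closure in $\mathbb{C}$. *)

(* Defs.v *)
From HB Require Import structures.
From mathcomp Require Import all_boot all_order all_algebra complex.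
From mathcomp Require Import all_classical all_reals all_analysis.

Set Implicit Arguments.
Unset Strict Implicit.
Unset Printing Implicit Defensive.

Import Order.TTheory GRing.Theory Num.Theory.
Import numFieldNormedType.Exports.

Local Open Scope classical_set_scope.
Local Open Scope ring_scope.
Local Open Scope complex_scope.

(* [R[i]] has no topology of its own; [R[i]^o] is the same type with the topology
   given by the norm [`|z|], i.e. the usual topology of the complex plane.
   [cexp z] is the sum of the exponential series, as for the library's [expR]. *)
Definition cexp {R : realType} (z : R[i]) : R[i] :=
  limn (series (fun n => z ^+ n / n`!%:R : R[i]^o)).

Definition lineL {R : realType} (alpha : R) (p : R[i]) : set R[i] :=
  [set p + t%:C * ('i + alpha%:C) | t in [set: R]].

(* Main.v *)
Require Import Defs.
From HB Require Import structures.
From mathcomp Require Import all_boot all_order all_algebra complex.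
From mathcomp Require Import all_classical all_reals all_analysis.
From mathcomp Require Import ring lra.

Set Implicit Arguments.
Unset Strict Implicit.
Unset Printing Implicit Defensive.

Import Order.TTheory GRing.Theory Num.Theory.
Import numFieldNormedType.Exports.

Local Open Scope classical_set_scope.
Local Open Scope ring_scope.
Local Open Scope complex_scope.

(** Since [alpha != 0], the exponential of the line is a logarithmic spiral around
    0, not a circle.  Up to complex conjugation one may take [alpha > 0], so that
    the spiral grows with [t].  With [cot psi = alpha], one turn of it is
      w(s) = x(s) + i y(s) = rho e^(alpha s) e^(i (s - psi)),
    where the turn enters only through the scale [rho], which takes arbitrarily
    large values, and where the shift by [psi] makes [s] the angle of the tangent:
      w'(s) = (rho / sin psi) e^(alpha s) e^(i s).
    It follows that (exp w)' is a positive multiple of e^(i (y + s)).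

    For small [s > 0] the spiral is close to the lowest point of its turn: it is
    nearly horizontal while [x] is large and positive.  For [rho] large, [y] still
    grows by more than a full period when [s] runs through a fixed compact
    interval of such parameters, so exp w crosses vertical lines there.
    Around a suitable crossing, [y + s] goes from pi/2 (mod 2 pi) to pi/2 + eta.
    Meanwhile Re (exp w) = e^x cos y decreases from a large positive to a large
    negative value, so it crosses every prescribed window [a, a + eps], while
    Im (exp w) grows at least cot eta times as fast as Re (exp w) decreases.
    Choosing [cot eta = 2 pi / eps], the imaginary part covers a full period
    while the real part is in the window.  Hence exp w comes within [eps] of
    [a + i b] modulo 2 pi i, for every [b], and one more exponential comes
    arbitrarily close to e^(a + i b), that is, to every nonzero number.  This is
    [spiral_hits], completed by the choice of [rho] in [spiral_near].

    The formula [cexpE] for the real and imaginary parts of the complex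
    exponential, which turns the theorem into this real statement, comes from a
    finite Cauchy product: the partial sums fail to be multiplicative by a sum of
    monomials that is dominated by the same sum at [`|u|] and [`|v|], which tends
    to 0 because [expR] is multiplicative. *)

(** * The complex exponential in real terms *)

Definition exp_sum (K : numFieldType) (x : K) (n : nat) : K :=
  \sum_(0 <= k < n) x ^+ k / k`!%:R.

Lemma exp_term_add (K : numFieldType) (u v : K) n :
  (u + v) ^+ n / n`!%:R =
  \sum_(0 <= i < n.+1) u ^+ i / i`!%:R * (v ^+ (n - i) / (n - i)`!%:R).
Proof.
rewrite addrC exprDn big_mkord mulr_suml; apply: eq_bigr => i _.
have lein : (i <= n)%N by rewrite -ltnS.
rewrite -(bin_fact lein) !natrM -mulr_natl.
have f0 k : k`!%:R != 0 :> K by rewrite pnatr_eq0 -lt0n fact_gt0.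
have b0 : 'C(n, i)%:R != 0 :> K by rewrite pnatr_eq0 -lt0n bin_gt0.
by field; rewrite !f0.
Qed.

(** The product of two partial sums runs over the square [i, j < n], the partial
    sum at [u + v] over the triangle [i + j < n]. *)
Lemma exp_sum_mul (K : numFieldType) (u v : K) n :
  exp_sum u n * exp_sum v n - exp_sum (u + v) n =
  \sum_(0 <= i < n) \sum_(n - i <= j < n)
    u ^+ i / i`!%:R * (v ^+ j / j`!%:R).
Proof.
have -> : exp_sum (u + v) n = \sum_(0 <= i < n) \sum_(0 <= j < n - i)
    u ^+ i / i`!%:R * (v ^+ j / j`!%:R).
  rewrite /exp_sum.
  under eq_bigr do rewrite exp_term_add.
  transitivity (\sum_(0 <= m < n) \sum_(0 <= i < n | (i < m.+1)%N)
      u ^+ i / i`!%:R * (v ^+ (m - i) / (m - i)`!%:R)).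
    by apply: eq_big_nat => m /andP[_ mn]; rewrite (big_nat_widen _ _ n).
  rewrite (exchange_big_dep_nat xpredT) //=.
  apply: eq_big_nat => i /andP[_ lin].
  rewrite -(big_nat_widenl i 0 n xpredT) // -{1}(add0n i) big_addn.
  by apply: eq_bigr => j _; rewrite addnK.
rewrite /exp_sum mulr_suml -sumrB; apply: eq_big_nat => i /andP[_ lin].
rewrite mulr_sumr (big_cat_nat (n := n - i)) ?leq_subr //=.
by rewrite addrAC subrr add0r.
Qed.

(** All coefficients of the defect of multiplicativity are nonnegative, so it is
    dominated by its value at the norms; there the arguments are real and
    [expRD] shows that it tends to 0. *)
Lemma norm_exp_sum_mul (K : numFieldType) (u v : K) n :
  `|exp_sum u n * exp_sum v n - exp_sum (u + v) n| <=
  exp_sum `|u| n * exp_sum `|v| n - exp_sum (`|u| + `|v|) n.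
Proof.
rewrite !exp_sum_mul; apply: le_trans (ler_norm_sum _ _ _) _.
apply: ler_sum => i _; apply: le_trans (ler_norm_sum _ _ _) _.
apply: ler_sum => j _.
by rewrite !normrM !normfV !normrX !normr_nat.
Qed.

Section Complex.
Variable R : realType.
Implicit Types x y : R.

Lemma cvg_exp_sum x : exp_sum x @ \oo --> expR x.
Proof.
have -> : exp_sum x = series (exp_coeff x) by [].
by have := is_cvg_series_exp_coeff x.
Qed.

Lemma exp_sum_real x n : exp_sum x%:C n = (exp_sum x n)%:C.
Proof.
rewrite /exp_sum rmorph_sum; apply: eq_bigr => k _.
by rewrite rmorphM rmorphXn fmorphV rmorph_nat.
Qed.

Lemma exp_sum_imaginary y n :
  exp_sum (0 +i* y) n = series (cos_coeff y) n +i* series (sin_coeff y) n.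
Proof.
have cM (a b c d : R) :
  (a +i* b) * (c +i* d) = (a * c - b * d) +i* (a * d + b * c) by [].
(* Even powers first: the coefficients of [cos] and [sin] are given by parity. *)
have pow2 m : (0 +i* y) ^+ m.*2 = ((-1) ^+ m * y ^+ m.*2) +i* 0.
  elim: m => [|m IHm]; first by rewrite mulr1.
  by rewrite doubleS 2!exprSr IHm !cM !exprS; congr (_ +i* _); ring.
have pow k : (0 +i* y) ^+ k =
    ((~~ odd k)%:R * (-1) ^+ k./2 * y ^+ k) +i*
    ((odd k)%:R * (-1) ^+ k.-1./2 * y ^+ k).
  rewrite -[k]odd_double_half; case: (odd k); set m := k./2.
    rewrite add1n exprS pow2 /= odd_double uphalf_double doubleK cM exprS.
    by congr (_ +i* _); rewrite /=; ring.
  rewrite add0n pow2 /= odd_double doubleK; congr (_ +i* _); rewrite /=; ring.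
apply: (big_ind3 (fun (z : R[i]) a b => z = a +i* b)) => //.
  by move=> z1 a1 b1 z2 a2 b2 -> ->.
move=> k _; rewrite pow.
have -> : (k`!%:R : R[i])^-1 = k`!%:R^-1 +i* 0 by rewrite complexr0 fmorphV rmorph_nat.
by rewrite cM; congr (_ +i* _); rewrite /cos_coeff /sin_coeff /= -?exprnP; ring.
Qed.

Lemma norm_complex_le x y : `|x +i* y| <= (`|x| + `|y|)%:C.
Proof.
rewrite normc_def lecR /= -(ger0_norm (addr_ge0 (normr_ge0 x) (normr_ge0 y))).
rewrite -sqrtr_sqr ler_sqrt ?sqr_ge0 // -(real_normK (num_real x)).
rewrite -(real_normK (num_real y)).
by have := mulr_ge0 (normr_ge0 x) (normr_ge0 y); nra.
Qed.

Lemma cvg_complex (f g : nat -> R) (a b : R) :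
  f @ \oo --> a -> g @ \oo --> b ->
  (fun n => f n +i* g n : R[i]^o) @ \oo --> (a +i* b : R[i]^o).
Proof.
move=> fa gb; apply/cvgrPdist_le => -[e e'].
rewrite ltcE /= => /andP[/eqP-> e0].
have e20 : 0 < e / 2 by rewrite divr_gt0.
move/cvgrPdist_le/(_ _ e20): fa; move/cvgrPdist_le/(_ _ e20): gb.
apply: filterS2 => n gn fn.
apply: le_trans (norm_complex_le (a - f n) (b - g n)) _.
by rewrite lecR (splitr e) lerD.
Qed.

Lemma cexpE x y : cexp (x +i* y) = (expR x * cos y) +i* (expR x * sin y).
Proof.
(* [d n] is the defect of multiplicativity at [x] and [i y]. *)
pose d n := exp_sum (x +i* y) n -
  ((exp_sum x n * series (cos_coeff y) n) +i*
   (exp_sum x n * series (sin_coeff y) n)).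
have dle n : `|d n| <=
    (exp_sum `|x| n * exp_sum `|y| n - exp_sum (`|x| + `|y|) n)%:C.
  have := norm_exp_sum_mul x%:C (0 +i* y) n.
  have -> : x%:C + (0 +i* y) = x +i* y by congr (_ +i* _); rewrite ?addr0 ?add0r.
  have -> : `|x%:C| = `|x|%:C.
    by rewrite normc_def /= expr0n addr0 sqrtr_sqr.
  have -> : `|0 +i* y| = `|y|%:C.
    by rewrite normc_def /= expr0n add0r sqrtr_sqr.
  rewrite -rmorphD !exp_sum_real exp_sum_imaginary -rmorphM -rmorphB distrC.
  congr (`|_ - _| <= _); congr (_ +i* _); rewrite /=; ring.
have bound0 : (fun n => exp_sum `|x| n * exp_sum `|y| n -
    exp_sum (`|x| + `|y|) n) @ \oo --> 0.
  rewrite -[X in _ --> X](subrr (expR `|x| * expR `|y|)) -{2}expRD.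
  by apply: cvgB; [apply: cvgM|]; exact: cvg_exp_sum.
have small (f : nat -> R) : (forall n, `|f n|%:C <= `|d n|) -> f @ \oo --> 0.
  move=> fd; apply/cvgr0Pnorm_le => e e0.
  move/cvgr0Pnorm_le/(_ _ e0): bound0; apply: filterS => n.
  apply: le_trans; rewrite -lecR; apply: le_trans (fd n) (le_trans (dle n) _).
  by rewrite lecR ler_norm.
have re0 : (fun n => complex.Re (d n)) @ \oo --> 0.
  by apply: small => n; exact: normc_ge_Re.
have im0 : (fun n => complex.Im (d n)) @ \oo --> 0.
  have normi : `|'i%C : R[i]| = 1 by rewrite normc_def /= expr0n expr1n add0r sqrtr1.
  apply: small => n; rewrite -normrN -ReiNIm; apply: le_trans (normc_ge_Re _) _.
  by rewrite normrM normi mulr1.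
rewrite /cexp; apply: (@cvg_lim R[i]^o); first exact: norm_hausdorff.
rewrite (_ : series _ = fun n =>
  (exp_sum x n * series (cos_coeff y) n + complex.Re (d n)) +i*
  (exp_sum x n * series (sin_coeff y) n + complex.Im (d n))); last first.
  apply/funext => n; rewrite /d [LHS](_ : _ = exp_sum (x +i* y) n) //.
  by case: (exp_sum (x +i* y) n) => u v /=; congr (_ +i* _); ring.
apply: cvg_complex.
  rewrite -[X in _ --> X]addr0; apply: cvgD re0; apply: cvgM; first exact: cvg_exp_sum.
  by rewrite unlock; have := @is_cvg_series_cos_coeff R y.
rewrite -[X in _ --> X]addr0; apply: cvgD im0; apply: cvgM; first exact: cvg_exp_sum.
by rewrite unlock; have := @is_cvg_series_sin_coeff R y.
Qed.
End Complex.

(** * Real functions with a known derivative *)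

Section Calculus.
Variable R : realType.
Implicit Types a b e s x y : R.

Lemma is_derive_continuous (f df : R -> R) a b :
  (forall x, is_derive x 1 f (df x)) -> {within `[a, b], continuous f}.
Proof. by move=> fd; apply: derivable_within_continuous. Qed.

Lemma is_derive_ge0_le (f df : R -> R) a b :
  (forall x, is_derive x 1 f (df x)) -> a <= b ->
  (forall x, a <= x <= b -> 0 <= df x) -> f a <= f b.
Proof.
move=> fd ab df0; rewrite -subr_ge0.
have [|c cab ->] := MVT_segment ab (fun x _ => fd x).
  exact: is_derive_continuous fd.
by rewrite mulr_ge0 ?subr_ge0 // df0 // -in_itv.
Qed.

Lemma is_derive_IVT (f df : R -> R) a b v :
  (forall x, is_derive x 1 f (df x)) -> a <= b -> f a <= v <= f b ->
  exists2 c, a <= c <= b & f c = v.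
Proof.
move=> fd ab /andP[av vb].
have [||c] := @IVT R f a b v ab; first exact: is_derive_continuous fd.
  by rewrite ge_min av le_max vb orbT.
by rewrite in_itv /= => cab fc; exists c.
Qed.

Lemma cos_sin_periodz x (k : int) :
  cos (x + (pi *+ 2) *~ k) = cos x /\ sin (x + (pi *+ 2) *~ k) = sin x.
Proof.
have pos (n : nat) (z : R) :
    cos (z + (pi *+ 2) *+ n) = cos z /\ sin (z + (pi *+ 2) *+ n) = sin z.
  by split; [exact: periodicn (@cosD2pi R) _ _|exact: periodicn (@sinD2pi R) _ _].
case: k => n; first exact: pos.
by have [] := pos n.+1 (x - (pi *+ 2) *+ n.+1); rewrite subrK => -> ->.
Qed.

(** Equality of angles modulo 2 pi is recorded by equality of [cos] and [sin],
    which is how the angles are used later. *)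
Lemma same_angle_in_turn x b : exists b',
  [/\ x <= b' <= x + pi *+ 2, cos b' = cos b & sin b' = sin b].
Proof.
have pi2 : 0 < pi *+ 2 :> R by rewrite mulrn_wgt0 ?pi_gt0.
pose k := Num.ceil ((x - b) / (pi *+ 2)).
have [ck sk] := cos_sin_periodz b k.
exists (b + (pi *+ 2) *~ k); split => //.
have := ceil_itv ((x - b) / (pi *+ 2)); rewrite -/k intrB.
rewrite ltr_pdivlMr // ler_pdivrMr // mulrBl mul1r -mulrzl => /andP[lo hi].
by apply/andP; split; lra.
Qed.

Lemma sin_le_pihalf x y : 0 <= x -> x <= y -> y <= pi / 2 -> sin x <= sin y.
Proof.
move=> x0 xy ypi.
apply: (is_derive_ge0_le (df := cos) _ xy) => z /andP[xz zy].
by apply: cos_ge0_pihalf; rewrite (le_trans zy ypi) andbT; have := pi_gt0 R; lra.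
Qed.

Lemma cos_ge_pi x y : 0 <= x -> x <= y -> y <= pi -> cos y <= cos x.
Proof.
move=> x0 xy ypi; rewrite -lerN2.
apply: (is_derive_ge0_le (f := \- cos) (df := sin) _ xy) => [z|z /andP[xz zy]].
  by rewrite -[sin z]opprK; apply: is_deriveN.
by apply: sin_ge0_pi; rewrite (le_trans x0 xz) (le_trans zy ypi).
Qed.

Lemma cot_surj (m : R) : 0 < m ->
  exists eta : R,
    [/\ 0 < eta < pi / 2, 0 < sin eta, 0 < cos eta & m * sin eta = cos eta].
Proof.
move=> m0; have lt_ := atan_gtNpi2 m^-1; have gt_ := atan_ltpi2 m^-1.
have c0 : 0 < cos (atan m^-1) by rewrite cos_gt0_pihalf // lt_.
have ms : m * sin (atan m^-1) = cos (atan m^-1).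
  have := atanK m^-1; rewrite /tan => /(congr1 (fun z => m * z * cos (atan m^-1))).
  by rewrite divff ?gt_eqF // mul1r mulrA divfK ?gt_eqF.
have s0 : 0 < sin (atan m^-1) by rewrite -(pmulr_rgt0 _ m0) ms.
exists (atan m^-1); split=> //; rewrite gt_ andbT ltNge; apply/negP => le0.
suff : 0 <= sin (- atan m^-1) by rewrite sinN oppr_ge0 leNgt s0.
by apply: sin_ge0_pi; rewrite oppr_ge0 le0 /=; have := pi_gt0 R; lra.
Qed.
End Calculus.

(** * The exponential of a logarithmic spiral *)

Section Spiral.
Variable R : realType.
Implicit Types a b e s x y : R.

Variables (alpha psi : R).
Hypothesis alpha_psi : alpha * sin psi = cos psi.
Hypothesis sin_psi_gt0 : 0 < sin psi.

Definition spiral_x (rho s : R) : R := rho * expR (alpha * s) * cos (s - psi).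
Definition spiral_y (rho s : R) : R := rho * expR (alpha * s) * sin (s - psi).

(** Since [alpha + i = e^(i psi) / sin psi], the tangent of the spiral has angle
    [s]; the shift by [psi] in the definitions is there for this. *)
Lemma is_derive_spiral_y rho s :
  is_derive s 1 (spiral_y rho) (rho * expR (alpha * s) / sin psi * sin s).
Proof.
rewrite /spiral_y; apply: is_derive_eq; rewrite /GRing.scale /=.
have -> : sin s = cos (s - psi) * sin psi + sin (s - psi) * cos psi.
  by rewrite addrC -sinD subrK.
by rewrite -alpha_psi; field; exact: lt0r_neq0.
Qed.

Lemma is_derive_spiral_x rho s :
  is_derive s 1 (spiral_x rho) (rho * expR (alpha * s) / sin psi * cos s).
Proof.
rewrite /spiral_x; apply: is_derive_eq; rewrite /GRing.scale /=.
have -> : cos s = cos (s - psi) * cos psi - sin (s - psi) * sin psi.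
  by rewrite -cosD subrK.
by rewrite -alpha_psi; field; exact: lt0r_neq0.
Qed.

Definition spiral_exp_re rho s := expR (spiral_x rho s) * cos (spiral_y rho s).
Definition spiral_exp_im rho s := expR (spiral_x rho s) * sin (spiral_y rho s).
(** The norm of the derivative of the exponential of the spiral. *)
Definition spiral_speed rho s :=
  expR (spiral_x rho s) * (rho * expR (alpha * s) / sin psi).

(** Differentiating [exp w] multiplies it by [w'], so the angle [y] of [exp w] and
    the angle [s] of [w'] add up. *)
Lemma is_derive_spiral_exp_re rho s :
  is_derive s 1 (spiral_exp_re rho) (spiral_speed rho s * cos (spiral_y rho s + s)).
Proof.
have hx := is_derive_spiral_x rho s; have hy := is_derive_spiral_y rho s.
rewrite /spiral_exp_re; apply: is_derive_eq.
rewrite /GRing.scale /= cosD /spiral_speed; ring.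
Qed.

Lemma is_derive_spiral_exp_im rho s :
  is_derive s 1 (spiral_exp_im rho) (spiral_speed rho s * sin (spiral_y rho s + s)).
Proof.
have hx := is_derive_spiral_x rho s; have hy := is_derive_spiral_y rho s.
rewrite /spiral_exp_im; apply: is_derive_eq.
rewrite /GRing.scale /= sinD /spiral_speed; ring.
Qed.

(** The angle [y + s] of (exp w)' increases along [[l, u]] by more than a turn, so
    it passes through an interval [[c, c + eta]] with [c = pi / 2] modulo 2 pi.
    There Re (exp w) decreases and Im (exp w) + M Re (exp w) increases, because
    [M sin mu <= cos mu] for [0 <= mu <= eta].  The bounds on e^x say that
    Re (exp w) traverses the window [[a, a + eps]] meanwhile; so Im (exp w) grows
    by at least [M eps >= 2 pi] inside the window and meets [b] modulo 2 pi. *)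
Lemma spiral_hits rho eta l u a b (M eps : R) :
  0 < rho -> 0 < eta < pi / 2 ->
  0 <= M -> M * sin eta <= cos eta -> pi *+ 2 <= M * eps -> 0 <= eps ->
  l <= u ->
  (forall s, l <= s <= u -> a + eps <= expR (spiral_x rho s) * sin s) ->
  (forall s, l <= s <= u -> - a <= expR (spiral_x rho s) * sin (eta - s)) ->
  (forall s, l <= s <= u -> 0 <= sin s) ->
  spiral_y rho l + l + (pi *+ 2 + eta) <= spiral_y rho u + u ->
  exists s, [/\ a <= spiral_exp_re rho s <= a + eps,
    cos (spiral_exp_im rho s) = cos b &
    sin (spiral_exp_im rho s) = sin b].
Proof.
move=> rho0 /andP[eta0 etapi] M0 Meta Meps eps0 lu hiX loX sin_ge0 turn.
pose tau s := spiral_y rho s + s.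
pose dy s := rho * expR (alpha * s) / sin psi * sin s.
have hy s : is_derive s 1 (spiral_y rho) (dy s) by exact: is_derive_spiral_y.
have htau s : is_derive s 1 tau (dy s + 1).
  by have := hy s => ?; rewrite /tau; apply: is_derive_eq.
have amp0 s : 0 < rho * expR (alpha * s) / sin psi.
  by rewrite divr_gt0 // mulr_gt0 // expR_gt0.
have speed0 s : 0 < spiral_speed rho s by rewrite mulr_gt0 ?expR_gt0.
have tau_mono s s' : l <= s -> s <= s' -> s' <= u -> tau s <= tau s'.
  move=> ls ss' s'u; apply: (is_derive_ge0_le htau ss') => z /andP[sz zs'].
  apply: addr_ge0 => //; apply: mulr_ge0; first exact: ltW.
  by apply: sin_ge0; rewrite (le_trans ls sz) (le_trans zs' s'u).
(* [tau = c] at [s1] and [tau = c + eta] at [s2] bound the crossing. *)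
have [c [/andP[lc cu] cosc sinc]] := same_angle_in_turn (tau l) (pi / 2).
rewrite cos_pihalf in cosc; rewrite sin_pihalf in sinc.
have [|s1 /andP[ls1 s1u] tau1] := is_derive_IVT (v := c) htau lu.
  by rewrite lc /=; rewrite /tau in lc cu *; lra.
have [|s2 /andP[s12 s2u] tau2] := is_derive_IVT (v := c + eta) htau s1u.
  by rewrite tau1 lerDl (ltW eta0) /=; rewrite /tau in lc cu *; lra.
have mu_bound s : s1 <= s <= s2 -> 0 <= tau s - c <= eta.
  move=> /andP[ss1 ss2].
  have := tau_mono _ _ ls1 ss1 (le_trans ss2 s2u).
  have := tau_mono _ _ (le_trans ls1 ss1) ss2 s2u.
  by rewrite tau1 tau2; lra.
have cos_tau s : cos (tau s) = - sin (tau s - c).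
  by rewrite -{1}(subrK c (tau s)) cosD cosc sinc mulr0 mulr1 sub0r.
have sin_tau s : sin (tau s) = cos (tau s - c).
  by rewrite -{1}(subrK c (tau s)) sinD cosc sinc mulr0 mulr1 add0r.
have X_nincr s s' : s1 <= s -> s <= s' -> s' <= s2 ->
    spiral_exp_re rho s' <= spiral_exp_re rho s.
  move=> ss1 ss' ss2; rewrite -lerN2.
  apply: (is_derive_ge0_le (f := \- spiral_exp_re rho)
    (df := fun s => - (spiral_speed rho s * cos (tau s))) _ ss') => [z|z /andP[sz zs']].
    by have := is_derive_spiral_exp_re rho z => ?; apply: is_deriveN.
  rewrite -/(tau z) cos_tau mulrN opprK mulr_ge0 ?(ltW (speed0 _)) //.
  have /andP[mu0 mueta] : 0 <= tau z - c <= eta.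
    by apply: mu_bound; rewrite (le_trans ss1 sz) (le_trans zs' ss2).
  by apply: sin_ge0_pi; rewrite mu0 (le_trans mueta) //; lra.
have YX_ndecr s s' : s1 <= s -> s <= s' -> s' <= s2 ->
    spiral_exp_im rho s + M * spiral_exp_re rho s <=
    spiral_exp_im rho s' + M * spiral_exp_re rho s'.
  move=> ss1 ss' ss2.
  apply: (is_derive_ge0_le (f := fun s => spiral_exp_im rho s + M * spiral_exp_re rho s)
    (df := fun s => spiral_speed rho s * (sin (tau s) + M * cos (tau s))) _ ss') =>
    [z|z /andP[sz zs']].
    have ? := is_derive_spiral_exp_re rho z; have ? := is_derive_spiral_exp_im rho z.
    by apply: is_derive_eq; rewrite /GRing.scale /= /tau; ring.
  have /andP[mu0 mueta] : 0 <= tau z - c <= eta.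
    by apply: mu_bound; rewrite (le_trans ss1 sz) (le_trans zs' ss2).
  rewrite mulr_ge0 ?(ltW (speed0 _)) // cos_tau sin_tau mulrN subr_ge0.
  apply: le_trans (ler_wpM2l M0 (sin_le_pihalf mu0 mueta (ltW etapi))) _.
  apply: le_trans Meta _; apply: cos_ge_pi => //; lra.
(* At [s1] and [s2] the angle of [exp w] is [c - s1] and [c + (eta - s2)]. *)
have X1 : a + eps <= spiral_exp_re rho s1.
  rewrite /spiral_exp_re (_ : spiral_y rho s1 = c - s1); last by rewrite -tau1 addrK.
  by rewrite cosB cosc sinc mul0r add0r mul1r hiX // ls1.
have X2 : spiral_exp_re rho s2 <= a.
  rewrite /spiral_exp_re (_ : spiral_y rho s2 = c + (eta - s2)); last first.
    by rewrite addrA -tau2 addrK.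
  rewrite cosD cosc sinc mul0r add0r mul1r mulrN lerNl loX // s2u.
  by rewrite (le_trans ls1).
have dNX s :
    is_derive s 1 (\- spiral_exp_re rho) (- (spiral_speed rho s * cos (tau s))).
  by have ? := is_derive_spiral_exp_re rho s; apply: is_deriveN.
have [|s3 /andP[s13 s32]] := is_derive_IVT (v := - (a + eps)) dNX s12.
  by rewrite /= !lerN2 X1 (le_trans X2) // lerDl.
move/oppr_inj => X3.
have [|s4 /andP[s34 s42]] := is_derive_IVT (v := - a) dNX s32.
  by rewrite /= !lerN2 X2 X3 lerDl eps0.
move/oppr_inj => X4.
(* The window is traversed on [[s3, s4]]. *)
have Y34 : spiral_exp_im rho s3 + pi *+ 2 <= spiral_exp_im rho s4.
  by have := YX_ndecr _ _ s13 s34 s42; rewrite X3 X4; lra.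
have [b' [/andP[lb ub] cosb sinb]] := same_angle_in_turn (spiral_exp_im rho s3) b.
have [|s /andP[s3s ss4] Ys] :=
    is_derive_IVT (v := b') (is_derive_spiral_exp_im rho) s34.
  by rewrite lb (le_trans ub).
exists s; rewrite Ys; split=> //; rewrite -X3 -{1}X4.
by rewrite !X_nincr // ?(le_trans s13) ?(le_trans ss4).
Qed.

End Spiral.

Section Real.
Variable R : realType.
Implicit Types a b c x y : R.

(** The interval of [s] is [[eta / 4, eta / 2]]: away from 0, so that [y] grows
    proportionally to [rho] and [sin s] is bounded below, and away from [eta], so
    that [sin (eta - s)] is bounded below as well.  On it [x] is at least a
    positive multiple of [rho]. *)
Lemma spiral_near (alpha psi a b eps : R) :
  alpha * sin psi = cos psi -> 0 < alpha -> 0 < sin psi -> 0 < cos psi ->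
  0 < eps ->
  exists K : R, forall rho, K <= rho -> exists s,
    [/\ a <= spiral_exp_re alpha psi rho s <= a + eps,
        cos (spiral_exp_im alpha psi rho s) = cos b &
        sin (spiral_exp_im alpha psi rho s) = sin b].
Proof.
move=> apsi alpha0 s0 c0 eps0.
have pi0 := pi_gt0 R.
have M0 : 0 < pi *+ 2 / eps by rewrite divr_gt0 // mulrn_wgt0.
have [eta [/andP[eta0 etapi] se ce Meta]] := cot_surj M0.
pose sg := sin (eta / 4).
have sg0 : 0 < sg by apply: sin_gt0_pi; lra.
pose C := cos eta * cos psi.
have C0 : 0 < C by rewrite mulr_gt0.
pose E := sg / sin psi * (eta / 4).
have E0 : 0 < E by rewrite mulr_gt0 // divr_gt0.
(* The first summand makes e^x large enough for the window, the second one makes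
   [y] grow by [3 pi], more than the required [2 pi + eta]. *)
exists ((`|a| + eps) / (C * sg) + (pi *+ 3) / E) => rho rhoK.
have K1 : 0 < (`|a| + eps) / (C * sg).
  by rewrite divr_gt0 ?mulr_gt0 // ltr_wpDl.
have K2 : 0 < pi *+ 3 / E by rewrite divr_gt0 // mulrn_wgt0.
have rho0 : 0 < rho by lra.
have rhoE : pi *+ 3 <= rho * E by rewrite -ler_pdivrMr //; lra.
have rhoC : `|a| + eps <= rho * (C * sg) by rewrite -ler_pdivrMr ?mulr_gt0 //; lra.
have expx s : eta / 4 <= s <= eta / 2 -> rho * C <= expR (spiral_x alpha psi rho s).
  move=> /andP[ls su].
  apply: (@le_trans _ _ (spiral_x alpha psi rho s)); last first.
    by have := expR_ge1Dx (spiral_x alpha psi rho s); lra.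
  rewrite /spiral_x -mulrA ler_pM2l // /C cosB.
  have e1 : 1 <= expR (alpha * s) by rewrite -expR0 ler_expR mulr_ge0; lra.
  have cs : cos eta <= cos s by apply: cos_ge_pi; lra.
  have ss : 0 <= sin s by apply: sin_ge0_pi; lra.
  apply: le_trans (ler_peMl _ e1); last first.
    by rewrite addr_ge0 // mulr_ge0 ?(ltW c0) ?(ltW s0) // (le_trans (ltW ce) cs).
  by apply: le_trans (ler_wpM2r (ltW c0) cs) _; rewrite lerDl mulr_ge0 // ltW.
have big s t : eta / 4 <= s <= eta / 2 -> sg <= t ->
    `|a| + eps <= expR (spiral_x alpha psi rho s) * t.
  move=> hs ht; apply: le_trans rhoC _; rewrite mulrA.
  by apply: ler_pM => //; rewrite ?expx // ?ltW // mulr_gt0.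
have an := ler_norm a; have aN := ler_norm (- a); rewrite normrN in aN.
have sgs s : eta / 4 <= s <= eta / 2 -> sg <= sin s.
  by move=> hs; apply: sin_le_pihalf; lra.
apply: (spiral_hits apsi s0 _ _ (eta := eta) (l := eta / 4) (u := eta / 2)
  (M := pi *+ 2 / eps)) => //; rewrite ?eta0 ?(ltW M0) ?Meta ?(ltW eps0) //.
- by rewrite divfK ?gt_eqF.
- lra.
- by move=> s hs; apply: le_trans (big s (sin s) hs (sgs s hs)); lra.
- move=> s hs; have := big s (sin (eta - s)) hs; have : sg <= sin (eta - s).
    by apply: sin_le_pihalf; lra.
  by move=> h /(_ h); lra.
- by move=> s hs; apply: le_trans (ltW sg0) (sgs s hs).
(* On the interval the slope of [y + s] is at least [rho sin (eta / 4) / sin psi]. *)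
pose f s := spiral_y alpha psi rho s + s - (rho * (sg / sin psi)) * s.
have : f (eta / 4) <= f (eta / 2).
  apply: (is_derive_ge0_le (f := f) (df := fun s =>
    rho * expR (alpha * s) / sin psi * sin s + 1 - rho * (sg / sin psi))).
  - move=> x; have ? := is_derive_spiral_y apsi s0 rho x.
    by rewrite /f; apply: is_derive_eq; rewrite /GRing.scale /=; ring.
  - lra.
  move=> s hs.
  have e1 : 1 <= expR (alpha * s) by rewrite -expR0 ler_expR mulr_ge0; lra.
  have : rho * (sg / sin psi) <= rho * expR (alpha * s) / sin psi * sin s.
    rewrite -!mulrA ler_pM2l // (mulrC sg) mulrA.
    rewrite ler_pM ?(ltW sg0) ?sgs ?invr_ge0 ?(ltW s0) //.
    by rewrite ler_peMl // invr_ge0 ltW.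
  lra.
have : rho * (sg / sin psi) * (eta / 4) = rho * E by rewrite -mulrA.
rewrite /f; lra.
Qed.

(** Adding [2 pi n] to the parameter keeps the angle and multiplies the scale
    [rho] by [e^(2 pi alpha n)], which exceeds any bound. *)
Lemma log_spiral_near_pos (alpha c q a b eps : R) : 0 < alpha -> 0 < eps ->
  exists t, let r := expR (alpha * t + c) in
    let x := r * cos (t + q) in let y := r * sin (t + q) in
    [/\ a <= expR x * cos y <= a + eps, cos (expR x * sin y) = cos b &
    sin (expR x * sin y) = sin b].
Proof.
move=> alpha0 eps0.
have [psi [_ s0 c0 apsi]] := cot_surj alpha0.
have [K HK] := spiral_near a b apsi alpha0 s0 c0 eps0.
pose T : R := pi *+ 2.
have T0 : 0 < T by rewrite mulrn_wgt0 // pi_gt0.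
pose d := c - alpha * (psi + q).
pose n := Num.truncn (`|(K - d) / (alpha * T)|).
have [|s [h1 h2 h3]] := HK (expR (d + alpha * (T *+ n.+1))).
  have h : (K - d) / (alpha * T) < n.+1%:R.
    by apply: le_lt_trans (ler_norm _) _; rewrite truncnS_gt.
  rewrite ltr_pdivrMr ?mulr_gt0 // in h.
  have := expR_ge1Dx (d + alpha * (T *+ n.+1)).
  by rewrite -mulr_natl mulrCA; lra.
exists (s - psi - q + T *+ n.+1).
have -> : alpha * (s - psi - q + T *+ n.+1) + c =
  (d + alpha * (T *+ n.+1)) + alpha * s by rewrite /d; ring.
rewrite expRD.
have -> : s - psi - q + T *+ n.+1 + q = s - psi + T *+ n.+1 by ring.
by rewrite (periodicn (@cosD2pi R)) (periodicn (@sinD2pi R)).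
Qed.

(** For [alpha < 0], complex conjugation of the spiral and [t |-> - t] lead back to
    the growing case, with [b] replaced by [- b]. *)
Lemma log_spiral_near (alpha c q a b eps : R) : alpha != 0 -> 0 < eps ->
  exists t, let r := expR (alpha * t + c) in
    let x := r * cos (t + q) in let y := r * sin (t + q) in
    [/\ a <= expR x * cos y <= a + eps, cos (expR x * sin y) = cos b &
    sin (expR x * sin y) = sin b].
Proof.
rewrite neq_lt => /orP[alpha0|]; last exact: log_spiral_near_pos.
move=> eps0; rewrite -oppr_gt0 in alpha0.
have [t] := log_spiral_near_pos c (- q) a (- b) alpha0 eps0.
have -> : - alpha * t = alpha * - t by ring.
have -> : t - q = - (- t + q) by ring.
rewrite /= !(cosN, sinN, mulrN).
by move=> [h1 h2 /oppr_inj h3]; exists (- t); rewrite /= mulrN.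
Qed.
End Real.

(** * Density *)

Lemma complex_polar (R : realType) (w : R[i]) : w != 0 ->
  exists a b, w = (expR a * cos b) +i* (expR a * sin b).
Proof.
case: w => u v w0.
pose r := Num.sqrt (u ^+ 2 + v ^+ 2).
have r0 : 0 < r.
  rewrite sqrtr_gt0 lt0r addr_ge0 ?sqr_ge0 // andbT.
  by rewrite paddr_eq0 ?sqr_ge0 // !sqrf_eq0; move: w0; rewrite eq_complex.
have r2 : r ^+ 2 = u ^+ 2 + v ^+ 2 by rewrite sqr_sqrtr // addr_ge0 ?sqr_ge0.
have q1 : (u / r) ^+ 2 + (v / r) ^+ 2 = 1.
  by rewrite !expr_div_n -mulrDl -r2 divff // expf_neq0 ?gt_eqF.
have ur : -1 <= u / r <= 1 by have := sqr_ge0 (v / r); nra.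
have ca : cos (acos (u / r)) = u / r by apply: acosK; rewrite in_itv.
have sa : sin (acos (u / r)) = `|v / r|.
  by rewrite sin_acos // -q1 addrAC subrr add0r sqrtr_sqr.
exists (ln r); rewrite lnK ?posrE //.
have [v0|v0] := leP 0 (v / r).
  exists (acos (u / r)); rewrite ca sa ger0_norm //.
  by congr (_ +i* _); rewrite mulrC divfK ?gt_eqF.
exists (- acos (u / r)); rewrite cosN sinN ca sa ltr0_norm // opprK.
by congr (_ +i* _); rewrite mulrC divfK ?gt_eqF.
Qed.

(** The outer exponential absorbs the multiples of 2 pi i, so only the distance in
    the real direction matters; continuity of [expR] at [a] makes it small. *)
Lemma lineL_image_near (R : realType) (p : R[i]) (alpha a b e : R) :
  alpha != 0 -> 0 < e ->
  exists2 z, lineL alpha p z &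
   `|cexp (cexp (cexp z)) - ((expR a * cos b) +i* (expR a * sin b))| < e%:C.
Proof.
move=> alpha0 e0; case: p => p1 p2.
have [eps eps0 near] : exists2 eps, 0 < eps &
    forall x, a <= x <= a + eps -> expR x - expR a < e / 2.
  pose a' := ln (expR a + e / 4).
  have pos : 0 < expR a + e / 4 by rewrite addr_gt0 ?expR_gt0 ?divr_gt0.
  exists (a' - a).
    by rewrite subr_gt0 -ltr_expR lnK ?posrE // ltrDl divr_gt0.
  move=> x /andP[_]; rewrite addrC subrK -ler_expR lnK ?posrE //; lra.
have [t [/andP[xa xa'] cosY sinY]] := log_spiral_near p1 p2 a b alpha0 eps0.
exists ((p1 +i* p2) + t%:C * ('i%R + alpha%:C)); first by exists t.
have -> : (p1 +i* p2) + t%:C * ('i%R + alpha%:C) = (alpha * t + p1) +i* (t + p2).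
  by rewrite -complexiE; congr (_ +i* _) => /=; ring.
rewrite !cexpE cosY sinY.
set x := expR _ * cos _ in xa xa' *.
have d0 : 0 <= expR x - expR a by rewrite subr_ge0 ler_expR.
have -> : expR x * cos b +i* (expR x * sin b) -
     (expR a * cos b +i* (expR a * sin b)) =
   ((expR x - expR a) * cos b) +i* ((expR x - expR a) * sin b).
  by congr (_ +i* _) => /=; ring.
apply: le_lt_trans (norm_complex_le _ _) _; rewrite ltcR !normrM ger0_norm //.
have := near x; rewrite xa xa' => /(_ isT).
have := cos_max b; have := sin_max b; nra.
Qed.

Theorem theorem3 (R : realType) (p : R[i]) (alpha : R) (halpha : alpha != 0) :
  closure ((cexp \o cexp \o cexp) @` lineL alpha p : set R[i]^o) = [set: R[i]].
Proof.
rewrite -subTset => w _ B /nbhs_ballP [[e e'] /=].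
rewrite ltcE /= => /andP[/eqP-> e0] ballB.
have [a [b wab]] : exists a b : R,
    `|w - ((expR a * cos b) +i* (expR a * sin b))| < (e / 2)%:C.
  have [->|/complex_polar[a [b ->]]] := eqVneq w 0; last first.
    by exists a, b; rewrite subrr normr0 ltcR divr_gt0.
  (* 0 is no value of the exponential; it is approached by a small one. *)
  exists (ln (e / 4)), 0; rewrite lnK ?posrE ?divr_gt0 // cos0 sin0 mulr0 mulr1.
  by rewrite sub0r normrN normc_def /= expr0n addr0 sqrtr_sqr ltcR gtr0_norm; lra.
have [|z Lz zab] := lineL_image_near p a b halpha (e := e / 2); first exact: divr_gt0.
exists (cexp (cexp (cexp z))); split; first by exists z.
apply: ballB; rewrite -ball_normE /=.
rewrite distrC in zab.
have -> : e +i* 0 = (e / 2)%:C + (e / 2)%:C :> R[i] by rewrite -rmorphD -splitr.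
apply: le_lt_trans (ltrD wab zab).
by apply: le_trans (ler_normD _ _); rewrite addrA subrK.
Qed.
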